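(* Let $f\in\mathcal{C}(\Sigma_N^+)$ and let $\xi:V_0\to\mathbb{R}$. If $\xi(p)=\int_{[p_1]}f\,\mathrm{d}\mu$ for every $p=(p_1p_1p_1\cdots)\in V_0$, then there exists $u\in\mathcal{D}_0$ satisfying $$\Delta u=f\quad\text{subject to}\quad (du)(p)=\xi(p)\ \text{ for } p\in V_0.$$
   Context: Fix an integer $N\ge 2$, $S=\{1,\dots,N\}$, and let $\Sigma_N^+=\{x=(x_1x_2\cdots):x_i\in S\}$ with the product topology. Cylinder sets: $[p_1\cdots p_m]=\{x: x_1=p_1,\dots,x_m=p_m\}$. $\mu$ is the Borel probability measure with $\mu([p_1\cdots p_m])=N^{-m}$. $\mathcal{C}(\Sigma_N^+)$ is the set of real continuous functions. For $m\ge 0$, $V_m$ is the set of sequences $p=(p_1\cdots p_m\,p_{m+1}\,p_{m+1}\cdots)$ that are constant from position $m+1$ on; in particular $V_0$ is the set of the $N$ constant sequences. $V_0\subset V_1\subset\cdots$, and $V_{-1}=\emptyset$. For $p\in V_m$, $\mathcal{U}_{p,m}=\{q\in V_m: q\ne p,\ q_i=p_i \text{ for } 1\le i\le m\}$ (a set of $N-1$ points; for $m=0$ it is $V_0\setminus\{p\}$). For $p\in\bigcup_m V_m$, $\kappa_p=\min\{j:p\in V_j\}$. For a real function $u$ defined (at least) on $V_m$ and $p\in V_m$, the difference operator is $$H_m u(p)=\sum_{j=\kappa_p}^{m}\ \sum_{q\in\mathcal{U}_{p,j}}(u(q)-u(p)).$$ Laplacian: for $u,f\in\mathcal{C}(\Sigma_N^+)$,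 $\Delta u=f$ means $\lim_{m\to\infty}\max_{p\in V_m\setminus V_{m-1}}\left|\frac{H_mu(p)}{\mu([p_1\cdots p_{m+1}])}-f(p)\right|=0$. $D_\mu$ is the set of $u\in\mathcal{C}(\Sigma_N^+)$ for which such an $f$ exists. $\mathcal{D}_0$ is the set of $u\in D_\mu$ for which there is $f\in\mathcal{C}(\Sigma_N^+)$ with $\Delta u=f$ and $\lim_{m\to\infty}\max_{p\in V_m\setminus V_0}\left|\frac{H_mu(p)}{\mu([p_1\cdots p_{m+1}])}-f(p)\right|=0$. Neumann derivative: for $u\in\mathcal{D}_0$ and $p\in V_0$, $(du)(p):=\lim_{m\to\infty}-H_mu(p)$ (this limit exists). *)

(* Defs.v *)
From HB Require Import structures.
From mathcomp Require Import all_boot all_order all_algebra.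
From mathcomp Require Import all_classical all_reals all_analysis.

Set Implicit Arguments.
Unset Strict Implicit.
Unset Printing Implicit Defensive.

Import Order.TTheory GRing.Theory Num.Theory.
Import numFieldNormedType.Exports.

Local Open Scope classical_set_scope.
Local Open Scope ring_scope.

(* The proof that N >= 2 is a parameter of the type only because measurable
   types must be pointed, and 'I_N is not pointed for an arbitrary N. *)
Definition alphabet (N : nat) (hN : (2 <= N)%N) : Type := 'I_N.

HB.instance Definition _ (N : nat) (hN : (2 <= N)%N) :=
  Choice.copy (alphabet hN) 'I_N.
HB.instance Definition _ (N : nat) (hN : (2 <= N)%N) :=
  isPointed.Build (alphabet hN) (Ordinal (ltnW hN)).

(* Sequences are indexed from 0: x i is the letter x_(i+1) of the usual
   one-based notation. *)
Definition seqs (N : nat) (hN : (2 <= N)%N) : Type :=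
  prod_topology (fun _ : nat => discrete_topology (alphabet hN)).

HB.instance Definition _ (N : nat) (hN : (2 <= N)%N) :=
  Pointed.on (seqs hN).
HB.instance Definition _ (N : nat) (hN : (2 <= N)%N) :=
  Topological.on (seqs hN).

Definition borel_seqs (N : nat) (hN : (2 <= N)%N) :=
  g_sigma_algebraType (@open (seqs hN)).

Section difference_operator.
Context (N : nat) (hN : (2 <= N)%N).
Implicit Types (p q : seqs hN) (m j : nat).

(* The cylinder of the word formed by the first m letters of p; every word of
   length m arises in this way. *)
Definition cylinder p m : set (seqs hN) :=
  [set x | forall i, (i < m)%N -> x i = p i].

Definition Vset m : set (seqs hN) :=
  [set p | forall i, (m <= i)%N -> p i = p m].

(* V_(m-1), where V_(-1) is empty *)
Definition Vpred m : set (seqs hN) := if m is k.+1 then Vset k else set0.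

Definition Uset p m : set (seqs hN) :=
  [set q | [/\ Vset m q, q <> p & forall i, (i < m)%N -> q i = p i]].

(* Least j such that p belongs to Vset j; the value is 0 (and never used) when p
   belongs to no Vset j. *)
Definition kappa p : nat :=
  [get j | Vset j p /\ forall k, Vset k p -> (j <= k)%N].

Definition Hdiff (R : realType) m (u : seqs hN -> R) p : R :=
  \sum_(kappa p <= j < m.+1) \sum_(q \in Uset p j) (u q - u p).

End difference_operator.

Arguments Vset {N} hN m.
Arguments Vpred {N} hN m.

Section laplacian.
Context (N : nat) (hN : (2 <= N)%N) (R : realType).
Context (mu : probability (borel_seqs hN) R).
Implicit Types (u f : seqs hN -> R) (p : seqs hN).

Definition laplacian_error u f m p : R :=
  `| Hdiff m u p / fine (mu (cylinder p m.+1)) - f p |.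

(* The index sets are finite, so that the suprema below are maxima, except for
   m = 0 in the second one, where the index set is empty. *)
Definition is_laplacian u f : Prop :=
  [/\ continuous u, continuous f &
      sup [set laplacian_error u f m p | p in Vset hN m `\` Vpred hN m]
        @[m --> \oo] --> (0 : R)].

Definition Dmu : set (seqs hN -> R) :=
  [set u | continuous u /\ exists f, is_laplacian u f].

Definition D0 : set (seqs hN -> R) :=
  [set u | Dmu u /\ exists f, [/\ continuous f, is_laplacian u f &
      sup [set laplacian_error u f m p | p in Vset hN m `\` Vset hN 0]
        @[m --> \oo] --> (0 : R)]].

(* (du)(p) exists and is equal to l *)
Definition is_neumann_derivative u p (l : R) : Prop :=
  - Hdiff m u p @[m --> \oo] --> l.

End laplacian.

(* Main.v *)
Require Import Defs.
From mathcomp Require Import all_boot all_order all_algebra.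
From mathcomp Require Import all_classical all_reals all_analysis.
From mathcomp Require Import measurable_realfun.
From mathcomp Require Import ring lra.

(** A solution u is written down explicitly.  For a word w let F w be the integral
of f over the cylinder [w]; then F w is the sum of the F (w b) over the letters b.
Write w b^oo for the sequence starting with w and constant equal to b afterwards.
For a nonempty word w with last letter c, the N points w b^oo form a cell, in
which only w c^oo was already present at the previous level.  Put u = 0 on V_0
and, going down the levels,

  u (w b^oo) = u (w c^oo) - (F w - F (w c) + F (w b)) / N   for b <> c.

These increments solve the linear system saying that the flux into each new
vertex from the other vertices of its cell, i.e. the sum over a of
u (w a^oo) - u (w b^oo), is F (w b).  The fluxes in a cell add up to 0, so the
flux into the old vertex w c^oo is F (w c) - F w ([flux_cell]).  In H_m u (p) the
fluxes of the successive cells containing p telescope: the result is the integral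
of f over [p_1 ... p_(m+1)] when p is not in V_0 ([Hdiff_potential]), and that
integral minus the integral over [p_1] when p is in V_0 ([Hdiff_potential_V0]).

Hence, off V_0, H_m u (p) divided by the measure of the cylinder is exactly the
mean of f over a cylinder containing p.  It is uniformly close to f (p) since f
is uniformly continuous by compactness ([mass_mean]); this gives both the
Laplacian and the membership in D_0.  On V_0 the limit of - H_m u (p) is the
integral of f over [p_1].  Finally the increments at depth k are O(2^-k), so u is
a uniformly convergent series of locally constant functions, hence continuous
([continuous_potential]). *)

Set Implicit Arguments.
Unset Strict Implicit.
Unset Printing Implicit Defensive.

Import Order.TTheory GRing.Theory Num.Theory.
Import numFieldNormedType.Exports.

Local Open Scope classical_set_scope.
Local Open Scope ring_scope.

(** * Cylinders, compactness and uniform continuity *)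

Section sequence_space.
Context (N : nat) (hN : (2 <= N)%N).
Implicit Types (p q x y : seqs hN) (m n : nat).

Lemma compact_seqs : compact [set: seqs hN].
Proof.
have fin : finite_set [set: discrete_topology (alphabet hN)].
  exact: (@finite_finset 'I_N).
have := tychonoff (fun _ : nat => finite_compact fin).
by congr (compact _); rewrite eqEsubset.
Qed.

Lemma cylinder_sym x y m : cylinder x m y -> cylinder y m x.
Proof. by move=> xy i im; rewrite xy. Qed.

Lemma cylinder_trans y x z m :
  cylinder x m y -> cylinder y m z -> cylinder x m z.
Proof. by move=> xy yz i im; rewrite yz ?xy. Qed.

Lemma cylinder_le x m n : (m <= n)%N -> cylinder x n `<=` cylinder x m.
Proof. by move=> mn y xy i im; apply: xy; apply: leq_trans mn. Qed.

Lemma nbhs_cylinder x m : nbhs x (cylinder x m).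
Proof.
elim: m => [|m IH]; first by near=> z => ?; rewrite ltn0.
have xm : nbhs x [set y | y m = x m].
  exists (proj m @^-1` [set x m]); split => //.
  suff : @open (seqs hN) (proj m @^-1` [set x m]) by [].
  apply: open_comp; [move=> + _; exact: proj_continuous|exact: discrete_open].
near=> z => i; rewrite ltnS leq_eqVlt => /predU1P[->|im].
  by near: z.
by rewrite (near IH z).
Unshelve. all: by end_near. Qed.

(** The cylinders around x form a base of neighbourhoods of x. *)
Lemma cylinder_nbhs x (U : set (seqs hN)) :
  nbhs x U -> exists m, cylinder x m `<=` U.
Proof.
move: U; have FF : Filter (filter_from setT (cylinder x)).
  apply: filter_from_filter; first by exists 0%N.
  move=> m n _ _; exists (maxn m n) => // y xy.
  split; apply: cylinder_le xy; [exact: leq_maxl|exact: leq_maxr].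
(* Convergence for a supremum topology is checked coordinate by coordinate. *)
suff : filter_from setT (cylinder x) --> x.
  by move=> Fx U /Fx[m _ mU]; exists m.
apply/cvg_sup => i U.
rewrite nbhsE => -[_ [[B oB <-] Bx] BU].
exists i.+1 => // y xy; apply: BU => /=.
by rewrite /preimage/= xy.
Qed.

Lemma open_cylinder x m : open (cylinder x m).
Proof.
rewrite openE => y xy; rewrite /interior.
apply: filterS (nbhs_cylinder y m) => z; exact: cylinder_trans.
Qed.

Lemma continuous_cylinderP (R : realType) (g : seqs hN -> R) :
  (forall e, 0 < e -> exists m, forall x y, cylinder x m y -> `|g x - g y| <= e)
  -> continuous g.
Proof.
move=> gu x; have Fx : Filter (nbhs x) by exact: nbhs_filter.
apply/(cvgrPdist_le (FF := Fx)) => e e0.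
have [m gm] := gu e e0.
by apply: filterS (nbhs_cylinder x m) => y; exact: gm.
Qed.

Lemma cylinder_unif_continuous (R : realType) (g : seqs hN -> R) :
  continuous g -> forall e, 0 < e ->
  exists m, forall x y, cylinder x m y -> `|g x - g y| <= e.
Proof.
move=> gc e e0.
(* The number m of letters plays the role of the parameter in the
   parametrised covering form of compactness. *)
have /compact_near_coveringP cover := compact_seqs.
pose P (m : nat) x := forall y, cylinder x m y -> `|g x - g y| <= e.
have : \forall m \near \oo, [set: seqs hN] `<=` P m.
  apply: cover.
  move=> x _; have Fx : Filter (nbhs x) by exact: nbhs_filter.
  have e2 : 0 < e / 2 by rewrite divr_gt0.
  have gx := iffLR (cvgrPdist_le (FF := Fx) g (g x)) (gc x) _ e2.
  have [n nP] : exists n, cylinder x n `<=` [set y | `|g x - g y| <= e / 2].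
    exact: cylinder_nbhs.
  exists (cylinder x n, [set m | (n <= m)%N]) => /=.
    by split; [exact: nbhs_cylinder|exists n].
  move=> [y m] /= [xy nm] z yz.
  have -> : g y - g z = (g x - g z) - (g x - g y) by ring.
  rewrite [e]splitr (le_trans (ler_normB _ _))// lerD//; last exact: nP.
  by apply: nP; apply: cylinder_trans xy (cylinder_le nm yz).
by move=> [m _ mP]; exists m => x y; exact: (mP m (leqnn m) x).
Qed.

End sequence_space.

(** * The finite vertex sets and the difference operator *)

Section cells.
Context (N : nat) (hN : (2 <= N)%N).
Implicit Types (p q x y : seqs hN) (m n j k : nat) (b : 'I_N).

(** The sequence whose first m letters are those of p and whose other letters
are all equal to b. *)
Definition extend p m b : seqs hN := fun i => if (i < m)%N then p i else b.

Lemma extend_lt p m b i : (i < m)%N -> extend p m b i = p i.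
Proof. by rewrite /extend => ->. Qed.

Lemma extend_ge p m b i : (m <= i)%N -> extend p m b i = b.
Proof. by rewrite /extend ltnNge => ->. Qed.

Lemma cylinder_extend p m b : cylinder p m (extend p m b).
Proof. by move=> i im; rewrite extend_lt. Qed.

Lemma Vset_extend p m b : Vset hN m (extend p m b).
Proof. by move=> i mi; rewrite !extend_ge. Qed.

Lemma Vset_le m n : (m <= n)%N -> Vset hN m `<=` Vset hN n.
Proof.
by move=> mn p Vp i ni; rewrite Vp ?(leq_trans mn)// -(Vp n).
Qed.

Lemma extend_Vset p m : Vset hN m p -> extend p m (p m) = p.
Proof.
move=> Vp; apply/funext => i; rewrite /extend.
by case: ltnP => // mi; rewrite Vp.
Qed.

Lemma Vset_predN p m : Vset hN m.+1 p -> ~ Vset hN m p -> p m != p m.+1.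
Proof.
move=> Vp; apply: contra_notN => /eqP pm i.
by rewrite leq_eqVlt => /predU1P[<-//|mi]; rewrite Vp// pm.
Qed.

Lemma kappaP p m : Vset hN m p ->
  Vset hN (kappa p) p /\ forall k, Vset hN k p -> (kappa p <= k)%N.
Proof.
move=> Vp.
suff /getPex : exists j, [set j | Vset hN j p /\
  forall k, Vset hN k p -> (j <= k)%N] j by [].
have ex : exists k, `[< Vset hN k p >] by exists m; apply/asboolP.
case: (ex_minnP ex) => j /asboolP Vj jmin; exists j; split=> // k Vk.
by apply: jmin; apply/asboolP.
Qed.

Lemma kappa0 p : Vset hN 0 p -> kappa p = 0%N.
Proof. by move=> Vp; have [_ /(_ _ Vp)] := kappaP Vp; case: kappa. Qed.

(** The last letter before the constant tail differs from the tail. *)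
Lemma kappa_pred p k : kappa p = k.+1 -> (exists m, Vset hN m p) ->
  p k != p k.+1.
Proof.
move=> kp [m /kappaP[]]; rewrite kp => Vk kmin; apply: Vset_predN => // /kmin.
by rewrite ltnn.
Qed.

(** The neighbours of p at level j are obtained by changing the constant tail of
p from position j on. *)
Lemma sum_Uset (R : realType) (G : seqs hN -> R) p j : Vset hN j p ->
  \sum_(q \in Uset p j) G q = \sum_(b < N | b != p j) G (extend p j b).
Proof.
move=> Vp.
have UE : Uset p j = [set extend p j b | b in [set b : 'I_N | b != p j]].
  apply/seteqP; split=> q /=.
    move=> [Vq qp pq]; exists (q j); last first.
      rewrite -[RHS](extend_Vset Vq); apply/funext => i; rewrite /extend.
      by case: ltnP => // /pq.
    apply/eqP => qj; apply: qp; rewrite -(extend_Vset Vq) qj.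
    rewrite -[RHS](extend_Vset Vp); apply/funext => i; rewrite /extend.
    by case: ltnP => // /pq.
  move=> [b bp <-]; split; [exact: Vset_extend| |exact: cylinder_extend].
  by move/(congr1 (@^~ j)) => /=; rewrite extend_ge// => /eqP; apply/negP.
rewrite UE fsbig_image; last first.
  move=> b b' _ _ /(congr1 (@^~ j)); by rewrite /= !extend_ge.
by rewrite [RHS]bigfs ?index_enum_uniq// => b; rewrite mem_index_enum.
Qed.

End cells.

(** * The potential of an additive function of cylinders *)

Lemma normr_half_lt1 (R : realType) : `|2^-1 : R| < 1.
Proof. by rewrite ger0_norm ?invr_ge0// invf_lt1 // ltr1n. Qed.

Section potential.
Context (N : nat) (hN : (2 <= N)%N) (R : realType).
(** F x m stands for the value of an additive function on the cylinder of the
first m letters of x; the three hypotheses say that it depends on these letters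
only, that it is additive, and that it is small on long cylinders. *)
Context (F : seqs hN -> nat -> R) (C : R).
Hypothesis F_local : forall x y m, cylinder x m y -> F y m = F x m.
Hypothesis F_add : forall x m, F x m = \sum_(b < N) F (extend x m b) m.+1.
Hypothesis F_le : forall x m, `|F x m| <= C / 2 ^+ m.
Implicit Types (p q x y : seqs hN) (m n j k : nat) (b : 'I_N).

(** The increment of the potential, in the cell of the word w of the first k + 1
letters of x, from the old vertex (whose tail is the last letter x k of w) to
the vertex with tail b, for b different from x k. *)
Definition cell_jump x k b : R :=
  - (F x k.+1 - F (extend x k.+1 (x k)) k.+2 + F (extend x k.+1 b) k.+2) / N%:R.

(** The increment picked up by x between the depths k and k + 1; it vanishes when
x k = x k.+1, since no new vertex is then reached. *)
Definition jump x k : R := if x k == x k.+1 then 0 else cell_jump x k (x k.+1).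

(** The sum of all increments along x.  It is a finite sum when x is eventually
constant. *)
Definition potential x : R := limn (series (jump x)).

Let N0 : (N%:R : R) != 0.
Proof. by rewrite pnatr_eq0; case: N hN. Qed.

Let C0 : 0 <= C.
Proof.
by have := le_trans (normr_ge0 _) (F_le point 0); rewrite expr0 divr1.
Qed.

Lemma cylinder_extend2 x y m b : cylinder x m y ->
  extend y m b = extend x m b.
Proof.
by move=> xy; apply/funext => i; rewrite /extend; case: ltnP => // /xy.
Qed.

Lemma jump_local x y k : cylinder x k.+2 y -> jump y k = jump x k.
Proof.
move=> xy; rewrite /jump /cell_jump !xy//.
rewrite !(cylinder_extend2 _ (cylinder_le (leqnSn _) xy)).
by rewrite (F_local (cylinder_le (leqnSn _) xy)).
Qed.

Lemma jump_le x k : `|jump x k| <= C / 2 ^+ k.+1.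
Proof.
rewrite /jump; case: ifP => _; first by rewrite normr0 divr_ge0 ?exprn_ge0.
have N2 : 2 <= N%:R :> R by rewrite ler_nat.
rewrite /cell_jump normrM normfV normrN (ger0_norm (ler0n _ N)).
rewrite ler_pdivrMr ?(lt_le_trans _ N2)//.
set a := F x _; set b := F (extend _ _ (x k)) _; set c := F _ _.
have ha : `|a| <= C / 2 ^+ k.+1 by exact: F_le.
have hb : `|b| <= C / 2 ^+ k.+2 by exact: F_le.
have hc : `|c| <= C / 2 ^+ k.+2 by exact: F_le.
have E : C / 2 ^+ k.+2 = C / 2 ^+ k.+1 / 2 by rewrite exprSr invfM mulrA.
rewrite {}E in hb hc.
have : 0 <= C / 2 ^+ k.+1 by rewrite divr_ge0 ?exprn_ge0.
move: (C / _) ha hb hc => D ha hb hc D0.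
have := ler_normD (a - b) c; have := ler_normB a b.
nra.
Qed.

Lemma jump_sum_le x n m : (n <= m)%N ->
  `|series (jump x) m - series (jump x) n| <= C / 2 ^+ n - C / 2 ^+ m.
Proof.
move=> nm; rewrite -(subnK nm) addnC; elim: (m - n)%N => [|d IH].
  by rewrite addn0 !subrr normr0.
have -> : series (jump x) (n + d.+1)%N = series (jump x) (n + d)%N + jump x (n + d)%N.
  by rewrite addnS /series/= big_nat_recr.
have := jump_le x (n + d)%N; rewrite addnS exprSr invfM mulrA.
move: IH; set s := series _ (n + d)%N; set t := series _ n; set a := jump _ _.
rewrite addrAC; have := ler_normD (s - t) a; lra.
Qed.

Lemma cvg_jump x : cvgn (series (jump x)).
Proof.
apply: normed_cvg.
apply: (@series_le_cvg R _ (geometric (C / 2) 2^-1)) => [n|n|n|].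
- exact: normr_ge0.
- by rewrite /= mulr_ge0 ?divr_ge0 ?exprn_ge0 ?invr_ge0.
- by rewrite /=; apply: le_trans (jump_le _ _) _; rewrite exprS exprVn invfM mulrA.
apply: is_cvg_geometric_series.
exact: normr_half_lt1.
Qed.

(** Uniform convergence of the series, with a geometric rate. *)
Lemma potential_tail x n : `|potential x - series (jump x) n| <= C / 2 ^+ n.
Proof.
have le m : (n <= m)%N -> `|series (jump x) m - series (jump x) n| <= C / 2 ^+ n.
  move=> nm; apply: le_trans (jump_sum_le x nm) _.
  by rewrite gerBl divr_ge0 ?exprn_ge0.
rewrite ler_distl; apply/andP; split.
  apply: limr_ge; first exact: cvg_jump.
  by exists n => // m /= /le; rewrite ler_distl => /andP[].
apply: limr_le; first exact: cvg_jump.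
by exists n => // m /= /le; rewrite ler_distl => /andP[].
Qed.

Lemma series_jump_local x y n : cylinder x n.+1 y ->
  series (jump y) n = series (jump x) n.
Proof.
move=> xy; rewrite /series/= !big_mkord; apply: eq_bigr => i _.
by apply: jump_local; apply: cylinder_le xy; rewrite ltnS.
Qed.

Lemma continuous_potential : continuous potential.
Proof.
apply: continuous_cylinderP => e e0.
have : geometric (C + C) (2^-1 : R) @ \oo --> (0 : R).
  by apply: cvg_geometric; exact: normr_half_lt1.
move=> /cvgrPdist_le/(_ _ e0)[n _ /(_ n (leqnn n)) ne].
exists n.+1 => x y xy.
have := potential_tail x n; have := potential_tail y n.
rewrite (series_jump_local xy) distrC => hy hx.
apply: le_trans ne; rewrite /= sub0r normrN.
rewrite [leRHS]ger0_norm ?mulr_ge0 ?addr_ge0 ?exprn_ge0 ?invr_ge0//.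
rewrite exprVn mulrDl.
have := ler_normD (potential x - series (jump x) n) (series (jump x) n - potential y).
rewrite addrA subrK; lra.
Qed.

(** The values of the potential at the vertices of a cell. *)
Lemma potential_cell x k b : potential (extend x k.+1 b) =
  series (jump x) k + (if b == x k then 0 else cell_jump x k b).
Proof.
set y := extend x k.+1 b.
have xy : cylinder x k.+1 y by exact: cylinder_extend.
have yk : jump y k = if b == x k then 0 else cell_jump x k b.
  rewrite /jump /cell_jump (cylinder_extend2 _ xy) (cylinder_extend2 (y k.+1) xy).
  by rewrite (F_local xy) (xy k)// /y extend_ge// eq_sym.
rewrite -yk -(series_jump_local xy).
apply: (@lim_near_cst R^o) => //.
exists k.+1 => // m /= km; rewrite /series/=.
rewrite (big_cat_nat (leq0n _) km)/= big_nat_recr//= [X in _ + X]big_nat_cond.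
rewrite [X in _ + X]big1 ?addr0// => i /andP[/andP[ki _] _].
by rewrite /jump /y !extend_ge ?eqxx// leqW.
Qed.

Lemma potential_V0 p : Vset hN 0 p -> potential p = 0.
Proof.
move=> Vp; apply: (@lim_near_cst R^o) => //.
exists 0%N => // m _; rewrite /series/= big1// => i _.
by rewrite /jump (Vp i)// (Vp i.+1)// eqxx.
Qed.

(** The level j part of the difference operator of the potential at p: the flux
into p from the other vertices of its cell of level j. *)
Definition flux p j : R :=
  \sum_(b < N | b != p j) (potential (extend p j b) - potential p).

Lemma flux_V0 p : Vset hN 0 p -> flux p 0 = 0.
Proof.
move=> Vp; rewrite /flux big1// => b _.
by rewrite !potential_V0 ?subr0//; exact: Vset_extend.
Qed.

(** If p is a new vertex of its cell of level k + 1, the flux into it is F on its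
cylinder; if p is the old vertex, the flux balances those into the new ones. *)
Lemma flux_cell p k : Vset hN k.+1 p ->
  flux p k.+1 = if p k == p k.+1 then F p k.+2 - F p k.+1 else F p k.+2.
Proof.
move=> Vp; rewrite /flux.
(* h b is the value at the vertex with tail b, up to a constant independent
   of b. *)
pose h b := if b == p k then 0 else cell_jump p k b.
transitivity (\sum_(b < N) h b - N%:R * h (p k.+1)).
  transitivity (\sum_(b < N) (h b - h (p k.+1))); last first.
    by rewrite big_split/= sumr_const card_ord mulr_natl mulNrn.
  rewrite [RHS](bigD1 (p k.+1))//= subrr add0r; apply: eq_bigr => b _.
  rewrite -[in potential p](extend_Vset Vp).
  by rewrite !potential_cell -!/(h _); ring.
(* The sum of all cell jumps is computed by additivity of F, removing the
   spurious term b = p k. *)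
have sh : \sum_(b < N) h b = F (extend p k.+1 (p k)) k.+2 - F p k.+1.
  have hE b : h b = cell_jump p k b - (if b == p k then cell_jump p k b else 0).
    by rewrite /h; case: eqP => _; rewrite ?subrr ?subr0.
  under eq_bigr do rewrite hE.
  rewrite big_split/= sumrN -big_mkcond/= big_pred1_eq.
  rewrite /cell_jump -mulr_suml sumrN big_split/= -F_add sumr_const card_ord.
  by rewrite -[_ *+ N]mulr_natr; field.
have Fp : F (extend p k.+1 (p k.+1)) k.+2 = F p k.+2 by rewrite extend_Vset.
rewrite sh /h eq_sym; case: ifPn => [/eqP pk|_].
  by rewrite pk Fp mulr0 subr0.
by rewrite /cell_jump Fp; field.
Qed.

Lemma Hdiff_flux m p : Vset hN m p ->
  Hdiff m potential p = \sum_(kappa p <= j < m.+1) flux p j.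
Proof.
move=> Vp; rewrite /Hdiff; apply: eq_big_nat => j /andP[kj _].
have [Vk _] := kappaP Vp.
by rewrite sum_Uset//; exact: Vset_le Vk.
Qed.

Lemma Hdiff_potential_V0 m p : Vset hN 0 p ->
  Hdiff m potential p = F p m.+1 - F p 1.
Proof.
move=> Vp; rewrite Hdiff_flux; last exact: Vset_le Vp.
rewrite kappa0// big_nat_recl// flux_V0// add0r.
rewrite -(telescope_sumr (fun i => F p i.+1))//.
apply: eq_big_nat => i _; rewrite flux_cell; last exact: Vset_le Vp.
by rewrite (Vp i)// (Vp i.+1)// eqxx.
Qed.

Lemma Hdiff_potential m p : Vset hN m p -> ~ Vset hN 0 p ->
  Hdiff m potential p = F p m.+1.
Proof.
move=> Vp V0; rewrite Hdiff_flux//.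
have [Vk kmin] := kappaP Vp.
case kE : (kappa p) => [|k]; first by rewrite kE in Vk.
rewrite kE in Vk; have km : (k < m)%N by rewrite -kE; exact: kmin.
(* p is a new vertex of its first cell and the old vertex of all later ones. *)
rewrite big_ltn// flux_cell// (negbTE (kappa_pred kE _)); last by exists m.
rewrite (eq_big_nat _ _ (F2 := fun j => F p j.+1 - F p j)).
  by rewrite telescope_sumr// addrC subrK.
move=> [//|j] /andP[kj _]; rewrite flux_cell; last exact: Vset_le (ltnW kj) _ Vk.
by rewrite (Vk j)// (Vk j.+1) ?(ltnW kj)// eqxx.
Qed.

End potential.

(** * Integrals of a continuous function over cylinders *)

Section mass.
Context (N : nat) (hN : (2 <= N)%N) (R : realType).
Context (mu : probability (borel_seqs hN) R).
Hypothesis hmu : forall (p : seqs hN) (m : nat),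
  mu (cylinder p m) = (N%:R ^- m)%:E.
Context (f : seqs hN -> R).
Hypothesis hf : continuous f.
Implicit Types (p q x y : seqs hN) (m n : nat).

(** The integral of f over the cylinder of the first m letters of x. *)
Definition mass x m : R := \int[mu]_(y in cylinder x m) f y.

Lemma measurable_cylinder x m :
  measurable (cylinder x m : set (borel_seqs hN)).
Proof. by apply: sub_sigma_algebra; exact: open_cylinder. Qed.

Lemma measurable_continuous :
  measurable_fun [set: borel_seqs hN] (f : borel_seqs hN -> R).
Proof.
apply: (measurability _ (RGenOpens.measurableE R)).
move=> _ [_ [a [b ->] <-]]; rewrite setTI; apply: sub_sigma_algebra.
by move/continuousP : hf; apply; exact: interval_open.
Qed.

Lemma continuous_bounded : exists C : R, forall x, `|f x| <= C.
Proof.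
have /compact_bounded[M [_ MP]] : compact (f @` [set: seqs hN]).
  apply: continuous_compact; last exact: compact_seqs.
  exact: continuous_subspaceT.
exists (M + 1) => x; apply: (MP (M + 1)); first by rewrite ltrDl.
by exists x.
Qed.

Lemma integrable_continuous (A : set (borel_seqs hN)) :
  measurable A -> mu.-integrable A (EFin \o f).
Proof.
move=> mA; apply: measurable_bounded_integrable => //.
- by apply: le_lt_trans (probability_le1 _ mA) _; rewrite ltry.
- by apply: measurable_funS measurable_continuous.
- have [C fC] := continuous_bounded.
  exists C; split; first exact: num_real.
  by move=> D CD x _ /=; apply: le_trans (fC x) (ltW CD).
Qed.

Lemma mass_local x y m : cylinder x m y -> mass y m = mass x m.
Proof.
move=> xy; rewrite /mass; congr (Rintegral _ _ _).
apply/seteqP; split=> z; apply: cylinder_trans => //.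
exact: cylinder_sym.
Qed.

Lemma mass_add x m : mass x m = \sum_(b < N) mass (extend x m b) m.+1.
Proof.
pose E (b : 'I_N) : set (borel_seqs hN) := cylinder (extend x m b) m.+1.
have mE b : measurable (E b) by exact: measurable_cylinder.
have -> : mass x m = \int[mu]_(y in \big[setU/set0]_(b < N) E b) f y.
  rewrite /mass; congr (Rintegral _ _ _).
  rewrite -bigcup_seq; apply/seteqP; split=> [y xy|y [b _ yb]].
    exists (y m); first by rewrite /= mem_index_enum.
    move=> i; rewrite ltnS leq_eqVlt => /predU1P[->|im].
      by rewrite extend_ge.
    by rewrite extend_lt// xy.
  by apply: cylinder_trans (cylinder_le (leqnSn m) yb); exact: cylinder_extend.
rewrite /Rintegral integral_bigsetU_EFin//.
- rewrite -sum_fine// => b _; apply: integrable_fin_num => //.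
  exact: integrable_continuous.
- exact: index_enum_uniq.
- move=> b c _ _ [y [yb yc]].
  by have := yb m (leqnn _); rewrite yc// !extend_ge.
- by apply/measurable_EFinP; apply: measurable_funS measurable_continuous => //.
Qed.

(** If f is e-close to c on a cylinder, its integral there is close to c times the
measure N^-m of the cylinder, up to e times that measure. *)
Lemma mass_close x m (c e : R) : (forall y, cylinder x m y -> `|f y - c| <= e) ->
  `|mass x m - c * N%:R ^- m| <= e * N%:R ^- m.
Proof.
move=> fe; pose A : set (borel_seqs hN) := cylinder x m.
have mA : measurable A by exact: measurable_cylinder.
have int_f : mu.-integrable A (EFin \o f) by exact: integrable_continuous.
have int_cst (a : R) : mu.-integrable A (EFin \o cst a).
  exact: finite_measure_integrable_cst.
have muA : mu A = (N%:R ^- m)%:E by exact: hmu.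
have cstE (a : R) : (\int[mu]_(y in A) a) = a * N%:R ^- m.
  by rewrite Rintegral_cst//; congr (a * _); rewrite -[RHS]/(fine _%:E) -muA.
have int_fc : mu.-integrable A (EFin \o (fun y => f y - c)).
  by have := integrableB mA int_f (int_cst c).
rewrite -(cstE c) -(cstE e) /mass -RintegralB//; last exact: int_cst.
apply: le_trans (le_normr_Rintegral _ _) _ => //.
apply: le_Rintegral => //; last exact: int_cst.
exact: integrable_abse int_fc.
Qed.

Lemma mass_le : exists C, forall x m, `|mass x m| <= C / 2 ^+ m.
Proof.
have [C fC] := continuous_bounded.
have C0 : 0 <= C := le_trans (normr_ge0 _) (fC point).
exists C => x m.
have : `|mass x m - 0 * N%:R ^- m| <= C * N%:R ^- m.
  by apply: mass_close => y _; rewrite subr0.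
rewrite mul0r subr0 => /le_trans; apply; rewrite ler_wpM2l//.
have N0 : 0 < N%:R :> R by rewrite ltr0n; case: N hN.
by rewrite lef_pV2 ?posrE ?exprn_gt0// lerXn2r ?nnegrE ?ler0n ?ler_nat.
Qed.

(** The means of f over the cylinders around x converge to f x, uniformly in x. *)
Lemma mass_mean e : 0 < e -> exists M, forall m x, (M <= m)%N ->
  `|mass x m / N%:R ^- m - f x| <= e.
Proof.
move=> /(cylinder_unif_continuous hf)[M fM]; exists M => m x Mm.
have N0 : 0 < N%:R ^- m :> R by rewrite invr_gt0 exprn_gt0// ltr0n; case: N hN.
have -> : mass x m / N%:R ^- m - f x =
    (mass x m - f x * N%:R ^- m) / N%:R ^- m.
  by rewrite mulrBl mulfK ?gt_eqF.
rewrite normrM normfV (gtr0_norm N0) ler_pdivrMr//.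
by apply: mass_close => y /(cylinder_le Mm)/fM; rewrite distrC.
Qed.

End mass.

(** * The solution of the Neumann problem *)

(** Uniform smallness on A m makes the suprema over A m tend to 0.  An empty A m is
harmless because the supremum of the empty set is 0. *)
Lemma cvg_sup0 (R : realType) (T : Type) (A : nat -> set T) (g : nat -> T -> R) :
  (forall m x, 0 <= g m x) ->
  (forall e, 0 < e -> exists M, forall m, (M <= m)%N -> forall x, A m x -> g m x <= e)
  -> sup [set g m x | x in A m] @[m --> \oo] --> (0 : R).
Proof.
move=> g0 gA; apply/cvgrPdist_le => e e0; have [M Me] := gA e e0.
exists M => // m /= Mm; rewrite sub0r normrN.
have [->|/set0P[x Ax]] := eqVneq (A m) set0.
  by rewrite image_set0 sup0 normr0 ltW.
rewrite ger0_norm.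
  by apply: ge_sup; [exists (g m x), x|move=> _ [y Ay <-]; exact: Me].
apply: le_trans (g0 m x) _; apply: sup_ubound; last by exists x.
by exists e => _ [y Ay <-]; exact: Me.
Qed.

Unset Implicit Arguments.

Theorem theorem6p3 (R : realType) (N : nat) (hN : (2 <= N)%N)
    (mu : probability (borel_seqs hN) R)
    (hmu : forall (p : seqs hN) (m : nat),
       mu (cylinder p m) = (N%:R ^- m)%:E)
    (f : seqs hN -> R) (hf : continuous f)
    (xi : seqs hN -> R)
    (hxi : forall p : seqs hN, Vset hN 0 p ->
       xi p = \int[mu]_(x in cylinder p 1) f x) :
  exists u : seqs hN -> R,
    [/\ D0 mu u,
        is_laplacian mu u f &
        forall p : seqs hN, Vset hN 0 p -> is_neumann_derivative u p (xi p)].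
Proof.
have [C leC] := mass_le hmu hf.
have loc := mass_local mu f.
have add := mass_add mu hf.
pose u := potential (mass mu f).
have cu : continuous u by exact: continuous_potential loc leC.
have err e : 0 < e -> exists M, forall m, (M <= m)%N -> forall p,
    Vset hN m p -> ~ Vset hN 0 p -> laplacian_error mu u f m p <= e.
  move=> /(mass_mean hmu hf)[M MP]; exists M => m Mm p Vp V0.
  rewrite /laplacian_error (Hdiff_potential loc add)// hmu.
  by apply: MP; exact: leqW.
(* A vertex of V_m outside V_(m-1) is outside V_0 once m > 0, so the estimate
   off V_0 covers both limits. *)
have lap : is_laplacian mu u f.
  split=> //; apply: cvg_sup0 => [m p|e e0]; first exact: normr_ge0.
  have [M MP] := err e e0; exists M.+1 => -[//|m] Mm p [Vp Vm].
  by apply: MP (ltnW Mm) _ Vp _ => V0; apply: Vm; exact: Vset_le V0.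
exists u; split=> //.
  split; first by split=> //; exists f.
  exists f; split=> //; apply: cvg_sup0 => [m p|e e0]; first exact: normr_ge0.
  by have [M MP] := err e e0; exists M => m Mm p [Vp Vm]; exact: MP.
move=> p Vp; rewrite /is_neumann_derivative hxi//.
have lim0 : mass mu f p m.+1 @[m --> \oo] --> (0 : R).
  apply: norm_cvg0.
  apply: (@squeeze_cvgr _ _ _ _ (cst 0) (geometric (C / 2) 2^-1)).
  - near=> m; rewrite /= normr_ge0/=; apply: le_trans (leC _ _) _.
    by rewrite exprS invfM mulrA exprVn.
  - exact: cvg_cst.
  - by apply: cvg_geometric; exact: normr_half_lt1.
under eq_fun do rewrite (Hdiff_potential_V0 loc add)// opprB.
suff : mass mu f p 1 - mass mu f p m.+1 @[m --> \oo] --> mass mu f p 1 - 0.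
  by rewrite subr0.
exact: cvgB (cvg_cst _) lim0.
Unshelve. all: by end_near. Qed.
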